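(* Let $m\ge2$ and let $a_1,a_2,b_1,b_2,b_3,c_1,\dots,c_{2m}\in\mathbb{C}$ with $a_1\ne a_2$, $b_1,b_2,b_3$ pairwise distinct, $c_1,\dots,c_{2m}$ pairwise distinct, and $ma_1+ma_2=b_1+(m-1)b_2+mb_3+\sum_{i=1}^{2m}c_i$. Let ${\bf B},{\bf C}$ be the $2m\times 2m$ matrices defined in the context (''even family''). Then ${\bf A}={\bf B}+{\bf C}$ is diagonalizable, with eigenvalues $a_1$ of multiplicity $m$ and $a_2$ of multiplicity $m$.
   Context: Notation: $p_i^{jk}=c_i+b_j-a_k$ and $q_{ij}=c_i+c_j+b_2+b_3-a_1-a_2$; empty products are $1$. Rows/columns are indexed $1,\dots,2m$. The matrix ${\bf B}$ has $B_{11}=b_1$, $B_{1+i,1+i}=b_2$ ($1\le i\le m-1$), $B_{m+i,m+i}=b_3$ ($1\le i\le m$), the entries $B_{1,1+j}=(-1)^{m+1-j}\frac{\prod_{k=j+1}^m q_{k,2m-j}}{\prod_{k=m+1}^{2m-1-j}(c_k-c_{2m-j})}$ ($1\le j\le m-1$), $B_{1,m+j}=(-1)^{m-j}p^{31}_{m+1-j}\frac{\prod_{k=m+j}^{2m-1}q_{m+1-j,k}}{\prod_{k=1}^{m-j}(c_k-c_{m+1-j})}$ ($1\le j\le m$), $B_{1+i,m+j}=(-1)^{m-j}p^{31}_{m+1-j}\frac{\prod_{k=1,k\ne m+1-j}^{i}q_{k,2m-i}\prod_{k=m+j,k\ne 2m-i}^{2m-1}q_{m+1-j,k}}{\prod_{k=2m+1-i}^{2m-1}(c_{2m-i}-c_k)\prod_{k=1}^{m-j}(c_k-c_{m+1-j})}$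 ($1\le i\le m-1$, $1\le j\le m$), and all other entries $0$. The matrix ${\bf C}$ has $C_{11}=c_{2m}$, $C_{1+i,1+i}=c_{2m-i}$ ($1\le i\le m-1$), $C_{m+i,m+i}=c_{m+1-i}$ ($1\le i\le m$), the entries $C_{1+i,1}=-\frac{\prod_{k=1}^i q_{k,2m-i}}{\prod_{k=2m+1-i}^{2m-1}(c_{2m-i}-c_k)}$ ($1\le i\le m-1$), $C_{m+i,1}=-p^{32}_{m+1-i}\frac{\prod_{k=m+1}^{m-1+i}q_{m+1-i,k}}{\prod_{k=m+2-i}^m(c_{m+1-i}-c_k)}$ ($1\le i\le m$), $C_{m+i,1+j}=(-1)^{m+1-j}p^{32}_{m+1-i}\frac{\prod_{k=m+1,k\ne2m-j}^{m-1+i}q_{m+1-i,k}\prod_{k=j+1,k\ne m+1-i}^m q_{k,2m-j}}{\prod_{k=m+2-i}^m(c_{m+1-i}-c_k)\prod_{k=m+1}^{2m-1-j}(c_k-c_{2m-j})}$ ($1\le i\le m$, $1\le j\le m-1$), and all other entries $0$. *)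

(* Defs.v *)
(* The complex field is modelled as R[i] (complex numbers
   over a real closed field R, from mathcomp-real-closed) with R : realType,
   i.e. the complex numbers built on the real numbers. *)
From HB Require Import structures.
From mathcomp Require Import all_boot all_order all_algebra.
From mathcomp Require Import reals.
From mathcomp Require Import complex.
Set Implicit Arguments. Unset Strict Implicit. Unset Printing Implicit Defensive.
Import Order.TTheory GRing.Theory Num.Theory.
Local Open Scope ring_scope.

Section EvenFamily.
Variable F : fieldType.
(* parameters; c is indexed 1..2m (c 0 unused), rows/cols are 1-based *)
Variables (m : nat) (a1 a2 b1 b2 b3 : F) (c : nat -> F).

Definition p31 (i : nat) : F := c i + b3 - a1.
Definition p32 (i : nat) : F := c i + b3 - a2.
Definition qq (i j : nat) : F := c i + c j + b2 + b3 - a1 - a2.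

(* \prod_{k=lo}^{hi}, empty (=1) when hi < lo *)
Definition Pr (lo hi : nat) (f : nat -> F) : F := \prod_(lo <= k < hi.+1) f k.
Definition Prx (lo hi x : nat) (f : nat -> F) : F :=
  \prod_(lo <= k < hi.+1 | k != x) f k.

Definition sgn (n : nat) : F := (-1) ^+ n.

Definition Bent (I J : nat) : F :=
  if (I == 1%N) && (J == 1%N) then b1
  else if [&& 2 <= I, I <= m & I == J]%N then b2
  else if [&& m.+1 <= I, I <= 2 * m & I == J]%N then b3
  else if [&& I == 1, 2 <= J & J <= m]%N then
    let j := (J - 1)%N in
    sgn (m + 1 - j) * Pr j.+1 m (fun k => qq k (2 * m - j))
      / Pr m.+1 (2 * m - 1 - j) (fun k => c k - c (2 * m - j))
  else if [&& I == 1, m.+1 <= J & J <= 2 * m]%N then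
    let j := (J - m)%N in
    sgn (m - j) * p31 (m + 1 - j)
      * Pr (m + j) (2 * m - 1) (fun k => qq (m + 1 - j) k)
      / Pr 1 (m - j) (fun k => c k - c (m + 1 - j))
  else if [&& 2 <= I, I <= m, m.+1 <= J & J <= 2 * m]%N then
    let i := (I - 1)%N in let j := (J - m)%N in
    sgn (m - j) * p31 (m + 1 - j)
      * (Prx 1 i (m + 1 - j) (fun k => qq k (2 * m - i))
         * Prx (m + j) (2 * m - 1) (2 * m - i) (fun k => qq (m + 1 - j) k))
      / (Pr (2 * m + 1 - i) (2 * m - 1) (fun k => c (2 * m - i) - c k)
         * Pr 1 (m - j) (fun k => c k - c (m + 1 - j)))
  else 0.

Definition Cent (I J : nat) : F :=
  if (I == 1%N) && (J == 1%N) then c (2 * m)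
  else if [&& 2 <= I, I <= m & I == J]%N then c (2 * m - (I - 1))
  else if [&& m.+1 <= I, I <= 2 * m & I == J]%N then c (m + 1 - (I - m))
  else if [&& 2 <= I, I <= m & J == 1]%N then
    let i := (I - 1)%N in
    - (Pr 1 i (fun k => qq k (2 * m - i))
       / Pr (2 * m + 1 - i) (2 * m - 1) (fun k => c (2 * m - i) - c k))
  else if [&& m.+1 <= I, I <= 2 * m & J == 1]%N then
    let i := (I - m)%N in
    - (p32 (m + 1 - i) * Pr m.+1 (m - 1 + i) (fun k => qq (m + 1 - i) k)
       / Pr (m + 2 - i) m (fun k => c (m + 1 - i) - c k))
  else if [&& m.+1 <= I, I <= 2 * m, 2 <= J & J <= m]%N then
    let i := (I - m)%N in let j := (J - 1)%N in
    sgn (m + 1 - j) * p32 (m + 1 - i)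
      * (Prx m.+1 (m - 1 + i) (2 * m - j) (fun k => qq (m + 1 - i) k)
         * Prx j.+1 m (m + 1 - i) (fun k => qq k (2 * m - j)))
      / (Pr (m + 2 - i) m (fun k => c (m + 1 - i) - c k)
         * Pr m.+1 (2 * m - 1 - j) (fun k => c k - c (2 * m - j)))
  else 0.

(* the 2m x 2m matrices; ordinal i : 'I_(2m) corresponds to row i+1 *)
Definition Bmx : 'M[F]_(2 * m) := \matrix_(i, j) Bent i.+1 j.+1.
Definition Cmx : 'M[F]_(2 * m) := \matrix_(i, j) Cent i.+1 j.+1.

End EvenFamily.

(* Main.v *)
(* Reverse the order of rows and columns, and split the indices as the border
   o = 2m, S = {m+1, ..., 2m-1} and T = {1, ..., m}. With nodes g_t = c_t on T
   and g_s = - (c_s + b2 + b3 - a1 - a2) on S one has q_{ts} = g_t - g_s, and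
   A is a bordered Cauchy-like matrix: its S x S and T x T blocks are diagonal,
   A_{st} = - A_{so} A_{ot} / q_{ts} and A_{ts} = - A_{to} A_{os} / q_{ts}.
   The products A_{ok} A_{ko} are then the weights of divided differences at
   the nodes, so every entry of (A - a1)(A - a2) reduces to a divided difference
   of a monic polynomial whose degree exceeds the order by at most two, which is
   an explicit symmetric function of nodes and roots. Hence (A - a1)(A - a2) = 0
   when no q_{ts} vanishes; the general case follows because the entries of A are
   polynomial in b2. The trace then fixes the two multiplicities. *)
Require Import Defs.
From HB Require Import structures.
From mathcomp Require Import all_boot all_order all_algebra.
From mathcomp Require Import reals.
From mathcomp Require Import complex.
From mathcomp Require Import ring zify.
Set Implicit Arguments. Unset Strict Implicit. Unset Printing Implicit Defensive.
Import Order.TTheory GRing.Theory Num.Theory.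
Local Open Scope ring_scope.

(** * Divided differences of monic split polynomials *)

Section DividedDifferences.
Variable F : fieldType.
Implicit Types (r s : seq F) (x y z : F).

(** For distinct nodes [r] this is the divided difference of the monic polynomial with root list
    [s]. Keeping the roots rather than the polynomial allows inductions that remove a node and a
    root together. *)
Definition divdiff r s : F :=
  \sum_(y <- r) (\prod_(x <- s) (y - x)) / (\prod_(z <- r | z != y) (y - z)).

(** Such a [p] equals its Lagrange interpolant [L], and the sum collects top coefficients, because
    each [l y] is monic of size [size r]. *)
Lemma divdiff_lagrange r (p : {poly F}) :
  uniq r -> (size p <= size r)%N ->
  \sum_(y <- r) p.[y] / (\prod_(z <- r | z != y) (y - z)) = p`_(size r).-1.
Proof.
move=> ur sp.
pose w y : F := \prod_(z <- r | z != y) (y - z).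
pose l y : {poly F} := \prod_(z <- r | z != y) ('X - z%:P).
have sl y : y \in r -> size (l y) = size r.
  move=> yr; rewrite /l -big_filter size_prod_XsubC.
  by rewrite -(rem_filter y ur) size_rem // prednK // lt0n size_eq0; case: (r) yr.
have w0 y : w y != 0.
  rewrite /w prodf_seq_neq0; apply/allP => z _; apply/implyP => zy.
  by rewrite subr_eq0 eq_sym.
pose L := \sum_(y <- r) (p.[y] / w y) *: l y.
have LE y : y \in r -> L.[y] = p.[y].
  move=> yr; rewrite horner_sum (bigD1_seq y) //= big1_seq ?addr0.
    rewrite hornerZ horner_prod.
    by under [X in _ * X]eq_bigr do rewrite hornerXsubC; rewrite -/(w y) divfK.
  move=> z /andP[zy zr]; apply/eqP; rewrite hornerZ mulf_eq0 horner_prod.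
  rewrite prodf_seq_eq0; apply/orP; right; apply/hasP; exists y => //.
  by rewrite hornerXsubC subrr eqxx andbT eq_sym.
suff pL : p = L.
  rewrite [in RHS]pL coef_sum; apply/eq_big_seq => y yr.
  rewrite coefZ -(sl y yr) -/(lead_coef _) (monicP _) ?mulr1 //.
  by rewrite /l -big_filter monic_prod_XsubC.
(* A nonzero [p - L] would vanish at all [size r] nodes, too many for its size. *)
apply/eqP; rewrite -subr_eq0; apply/negPn/negP => nz.
have rts : all (root (p - L)) r.
  by apply/allP => y yr; rewrite rootE hornerD hornerN subr_eq0 LE.
have := max_poly_roots nz rts ur; rewrite ltnNge => /negP; apply.
rewrite (leq_trans (size_polyD _ _)) // geq_max sp size_polyN.
apply: (leq_trans (size_sum _ _ _)).
by apply/bigmax_leqP_seq => y yr _; rewrite (leq_trans (size_scale_leq _ _)) // sl.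
Qed.

Lemma divdiff_monic r s : uniq r -> size r = (size s).+1 -> divdiff r s = 1.
Proof.
move=> ur srs; have := divdiff_lagrange (p := \prod_(x <- s) ('X - x%:P)) ur.
rewrite size_prod_XsubC srs => /(_ (leqnn _)) /= E.
have <- : (\prod_(x <- s) ('X - x%:P))`_(size s) = 1 :> F.
  have /monicP := monic_prod_XsubC s xpredT id.
  by rewrite /lead_coef size_prod_XsubC.
rewrite -E; apply: eq_bigr => y _; congr (_ / _).
by rewrite horner_prod; apply: eq_bigr => x _; rewrite hornerXsubC.
Qed.

(** Write [z - x = (z - y) + (y - x)] in the term of each node [z]: the first summand cancels the
    node [y], the second keeps all nodes. *)
Lemma divdiff_cons y r x s : uniq (y :: r) ->
  divdiff (y :: r) (x :: s) = divdiff r s + (y - x) * divdiff (y :: r) s.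
Proof.
move=> /= /andP[yr ur]; rewrite /divdiff !big_cons eqxx /=.
rewrite mulrDr [in RHS]addrCA.
congr (_ + _); first by rewrite mulrA.
rewrite mulr_sumr -big_split /=; apply: eq_big_seq => z zr.
rewrite !big_cons; have zy : y != z by apply: contraNneq yr => ->.
rewrite zy; set w := (\prod_(_ <- r | _) _).
have w0 : w != 0.
  rewrite prodf_seq_neq0; apply/allP => t _; apply/implyP => tz.
  by rewrite subr_eq0 eq_sym.
have zy0 : z - y != 0 by rewrite subr_eq0 eq_sym.
field; exact/andP.
Qed.

(** Each use of [divdiff_cons] contributes [y - x] times a divided difference with one root fewer
    than nodes, which is 1. *)
Lemma divdiff_eq_size r s : uniq r -> size r = size s ->
  divdiff r s = \sum_(y <- r) y - \sum_(x <- s) x.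
Proof.
elim: r s => [|y r IH] [|x s] // ur; first by rewrite /divdiff !big_nil subrr.
move=> [srs]; rewrite divdiff_cons // IH //; last by case/andP: ur.
by rewrite divdiff_monic /= ?srs // !big_cons; ring.
Qed.

(** This is the identity 2 h_2 = p_1^2 + p_2 for the complete symmetric function of nodes minus
    roots; doubling avoids a division by 2 in an arbitrary field. *)
Lemma divdiff_succ_size r s : uniq r -> size s = (size r).+1 ->
  2 * divdiff r s = (\sum_(y <- r) y - \sum_(x <- s) x) ^+ 2
                    + (\sum_(y <- r) y ^+ 2 - \sum_(x <- s) x ^+ 2).
Proof.
elim: r s => [|y r IH] [|x s] // ur [srs].
  by case: s srs => // _; rewrite /divdiff !big_cons !big_nil; ring.
rewrite divdiff_cons // mulrDr IH //; last by case/andP: ur.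
by rewrite divdiff_eq_size /= ?srs // !big_cons; ring.
Qed.

End DividedDifferences.

(** * Matrices satisfying a quadratic equation *)

Lemma prod_XsubC_pred2 (R : comNzRingType) (a1 a2 : R) (r : seq R) :
  {subset r <= [:: a1; a2]} ->
  exists k l, [/\ size r = (k + l)%N,
    \prod_(z <- r) ('X - z%:P) = ('X - a1%:P) ^+ k * ('X - a2%:P) ^+ l
    & \sum_(z <- r) z = k%:R * a1 + l%:R * a2].
Proof.
elim: r => [|x r IH] sub.
  by exists 0%N, 0%N; rewrite !big_nil !mul0r addr0 mulr1.
have [|k [l [sr pr sumr]]] := IH.
  by move=> z zr; apply: sub; rewrite inE zr orbT.
rewrite /= sr !big_cons pr sumr.
have := sub x (mem_head _ _); rewrite !inE => /orP[] /eqP ->.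
  by exists k.+1, l; split; [lia | rewrite exprS mulrA | rewrite -natr1; ring].
exists k, l.+1; split; [lia | rewrite exprS; ring | rewrite -natr1; ring].
Qed.

Section QuadraticMatrix.
Variables (F : numClosedFieldType) (n : nat) (A : 'M[F]_n) (a1 a2 : F).
Hypothesis A_quad : A *m A = (a1 + a2) *: A - (a1 * a2)%:M.

Lemma quadratic_eigenvalue x : eigenvalue A x -> x \in [:: a1; a2].
Proof.
move=> /eigenvalueP[v vA v0]; rewrite !inE -(subr_eq0 x) -(subr_eq0 x a2) -mulf_eq0.
have : v *m (A *m A) = (x * x) *: v by rewrite mulmxA vA -scalemxAl vA scalerA.
rewrite A_quad mulmxBr -scalemxAr vA mul_mx_scalar scalerA -scalerBl => /eqP.
rewrite -subr_eq0 -scalerBl scaler_eq0 (negPf v0) orbF => /eqP E.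
apply/eqP; transitivity (- ((a1 + a2) * x - a1 * a2 - x * x)); first by ring.
by rewrite E oppr0.
Qed.

(** The minimal polynomial divides the product of ['X - a1%:P] and ['X - a2%:P], whose roots are
    simple. *)
Lemma quadratic_diagonalizable : a1 != a2 -> diagonalizable A.
Proof.
(* The minimal polynomial criterion concerns matrices of positive size, so the empty matrix is
   settled directly. *)
move=> a12; case: n A A_quad => [|n'] A' A'_quad.
  exists 1%:M; first exact: unitmx1.
  by apply/is_diag_mxP => -[].
apply/diagonalizableP; exists [:: a1; a2]; first by rewrite /= inE a12.
apply/mxminpoly_minP; rewrite !big_cons big_nil mulr1 rmorphM /= !rmorphB /=.
rewrite !horner_mx_X !horner_mx_C -mulmxE mulmxBl !mulmxBr A'_quad.
rewrite mul_mx_scalar !mul_scalar_mx scale_scalar_mx.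
by rewrite scalerDl; apply/matrixP => i j; rewrite !mxE; ring.
Qed.

Lemma quadratic_char_poly m : n = (2 * m)%N -> a1 != a2 ->
  \tr A = m%:R * a1 + m%:R * a2 ->
  char_poly A = ('X - a1%:P) ^+ m * ('X - a2%:P) ^+ m.
Proof.
move=> nm a12 trA; have [r] := closed_field_poly_normal (char_poly A).
rewrite (monicP (char_poly_monic _)) scale1r => cA.
have sr : size r = n.
  by have := size_char_poly A; rewrite cA size_prod_XsubC => -[].
have [|k [l [skl pE sumE]]] := @prod_XsubC_pred2 _ a1 a2 r.
  move=> z zr; apply: quadratic_eigenvalue.
  by rewrite eigenvalue_root_char cA root_prod_XsubC.
rewrite cA pE.
rewrite sr nm in skl.
suff km : k = m by rewrite km (_ : l = m) //; lia.
case: (posnP n) => [n0|n_gt0]; first by lia.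
have := char_poly_trace A n_gt0; rewrite cA -{1}sr coefPn_prod_XsubC ?sr -?lt0n //.
move=> /oppr_inj; rewrite sumE trA.
have -> : l = (m + m - k)%N by lia.
rewrite natrB ?natrD; last by lia.
(* With [l] replaced by 2m - k, the trace equation is linear in [k], and characteristic zero
   recovers [k = m]. *)
move=> E; have : (k%:R - m%:R) * (a1 - a2) = 0.
  transitivity ((k%:R * a1 + (m%:R + m%:R - k%:R) * a2) - (m%:R * a1 + m%:R * a2)); first by ring.
  by rewrite E subrr.
by move/eqP; rewrite mulf_eq0 !subr_eq0 (negPf a12) orbF eqr_nat => /eqP.
Qed.

End QuadraticMatrix.

(** * Squares of bordered matrices with two diagonal blocks *)

Section BorderedBlocks.
Variables (F : fieldType) (I : eqType) (M : I -> I -> F) (o : I) (a1 a2 : F).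

(** For [k] and [l] in opposite blocks, the (k, l) entry of the quadratic equation says that
    [M k l * cross_gap k l] is the opposite of [M k o * M o l]. For the even family this gap is a
    q. *)
Definition cross_gap k l := M k k + M l l - a1 - a2.
Definition loop_weight k := M o k * M k o.

(** Conditions attached to the block [S]; exchanging [S] and [T] gives those of the other block, so
    every computation is done once. The three sums over [T] control, in order, the border entries,
    the off-diagonal entries and the diagonal entries of the square at [S]. *)
Record bordered_half (S T : seq I) : Prop := BorderedHalf {
  bh_uniq : uniq S;
  bh_diag : {in S &, forall s s', s != s' -> M s s' = 0};
  bh_neq0 : {in S & T, forall s t, cross_gap s t != 0};
  bh_cross : {in S & T, forall s t, M s t = - (M s o * M o t / cross_gap s t)};
  bh_sum1 : {in S, forall s, \sum_(t <- T) loop_weight t / cross_gap s t = M o o + M s s - a1 - a2};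
  bh_sum2 : {in S &, forall s s', s != s' ->
    \sum_(t <- T) loop_weight t / (cross_gap s t * cross_gap s' t) = -1};
  bh_sum3 : {in S, forall s,
    (M s s - a1) * (M s s - a2) + loop_weight s * (1 + \sum_(t <- T) loop_weight t / cross_gap s t ^+ 2) = 0}
}.

Lemma cross_gapC k l : cross_gap k l = cross_gap l k. Proof. by rewrite /cross_gap; ring. Qed.

Lemma sum_diag_r S T : bordered_half S T -> forall s, s \in S -> forall f : I -> F,
  \sum_(j <- S) f j * M j s = f s * M s s.
Proof.
move=> h s sS f; rewrite (bigD1_seq s) ?(bh_uniq h) //= big1_seq ?addr0 //.
by move=> j /andP[js jS]; rewrite (bh_diag h) ?mulr0.
Qed.

Lemma sum_diag_l S T : bordered_half S T -> forall s, s \in S -> forall f : I -> F,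
  \sum_(j <- S) M s j * f j = M s s * f s.
Proof.
move=> h s sS f; rewrite (bigD1_seq s) ?(bh_uniq h) //= big1_seq ?addr0 //.
by move=> j /andP[js jS]; rewrite (bh_diag h) ?mul0r // eq_sym.
Qed.

Definition bordered_sq S T k l :=
  M k o * M o l + \sum_(j <- S) M k j * M j l + \sum_(j <- T) M k j * M j l.

Lemma bordered_sqC S T k l : bordered_sq S T k l = bordered_sq T S k l.
Proof. by rewrite /bordered_sq addrAC. Qed.

Variables (S T : seq I).
Hypotheses (hS : bordered_half S T) (hT : bordered_half T S).

Lemma sq_border_r s : s \in S -> bordered_sq S T o s = (a1 + a2) * M o s.
Proof.
move=> sS; rewrite /bordered_sq (sum_diag_r hS) //.
have -> : \sum_(j <- T) M o j * M j s = - (M o s * \sum_(t <- T) loop_weight t / cross_gap s t).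
  rewrite mulr_sumr -sumrN; apply: eq_big_seq => t tT.
  by rewrite (bh_cross hT tT sS) (cross_gapC t) /loop_weight; ring.
by rewrite (bh_sum1 hS) //; ring.
Qed.

Lemma sq_border_l s : s \in S -> bordered_sq S T s o = (a1 + a2) * M s o.
Proof.
move=> sS; rewrite /bordered_sq (sum_diag_l hS) //.
have -> : \sum_(j <- T) M s j * M j o = - (M s o * \sum_(t <- T) loop_weight t / cross_gap s t).
  rewrite mulr_sumr -sumrN; apply: eq_big_seq => t tT.
  by rewrite (bh_cross hS sS tT) /loop_weight; ring.
by rewrite (bh_sum1 hS) //; ring.
Qed.

(** Both blocks are diagonal, so only [o], [s] and [t] contribute as intermediate indices; what
    remains is [bh_cross] cleared of its denominator. *)
Lemma sq_cross s t : s \in S -> t \in T -> bordered_sq S T s t = (a1 + a2) * M s t.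
Proof.
move=> sS tT; rewrite /bordered_sq (sum_diag_l hS) // (sum_diag_r hT) //.
have := bh_neq0 hS sS tT; rewrite (bh_cross hS sS tT) /cross_gap => q0; field; exact: q0.
Qed.

(** Two cross relations meet at each [t], so the sum over [T] is [M s o * M o s'] times a weighted
    sum. By [bh_sum2] it cancels the border term when [s != s']; the diagonal case is [bh_sum3]. *)
Lemma sq_block s s' : s \in S -> s' \in S ->
  bordered_sq S T s s' = (a1 + a2) * M s s' - (a1 * a2) *+ (s == s').
Proof.
move=> sS s'S; rewrite /bordered_sq (sum_diag_l hS) //.
have -> : \sum_(j <- T) M s j * M j s' =
    M s o * M o s' * \sum_(t <- T) loop_weight t / (cross_gap s t * cross_gap s' t).
  rewrite mulr_sumr; apply: eq_big_seq => t tT.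
  by rewrite (bh_cross hS sS tT) (bh_cross hT tT s'S) (cross_gapC t) /loop_weight invfM; ring.
have [->|ss'] := eqVneq s s'; last first.
  by rewrite (bh_sum2 hS) // (bh_diag hS sS s'S) // mulr0n; ring.
have := bh_sum3 hS s'S; under eq_bigr do rewrite expr2.
set X := \sum_(_ <- _) _; rewrite /loop_weight mulr1n => E.
by apply/eqP; rewrite -subr_eq0 -[X in _ == X]E; apply/eqP; ring.
Qed.

End BorderedBlocks.

(** Of the nine block positions only the corner requires its own equation; the others come from the
    two halves, with [S] and [T] exchanged where necessary. *)
Lemma bordered_square (F : fieldType) (I : eqType) (M : I -> I -> F) (o : I)
    (a1 a2 : F) (S T : seq I) :
  bordered_half M o a1 a2 S T -> bordered_half M o a1 a2 T S ->
  uniq (o :: S ++ T) ->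
  (M o o - a1) * (M o o - a2) + \sum_(s <- S) M o s * M s o
    + \sum_(t <- T) M o t * M t o = 0 ->
  {in o :: S ++ T &, forall k l, \sum_(j <- o :: S ++ T) M k j * M j l =
     (a1 + a2) * M k l - (a1 * a2) *+ (k == l)}.
Proof.
move=> hS hT /= /andP[oST]; rewrite cat_uniq => /and3P[uS /hasPn dST uT] h0 k l.
move: oST; rewrite mem_cat negb_or => /andP[oS oT].
rewrite big_cons big_cat /= addrA -/(bordered_sq M o S T k l).
have nST s t : s \in S -> t \in T -> (s == t) = false.
  by move=> sS tT; apply/eqP => E; have := dST _ tT; rewrite /= -E sS.
have no s : s \in S ++ T -> (o == s) = false.
  by rewrite mem_cat => sST; apply/eqP => E; move: sST; rewrite -E (negPf oS) (negPf oT).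
rewrite !inE !mem_cat => /or3P[/eqP->|kS|kT] /or3P[/eqP->|lS|lT].
- rewrite /bordered_sq eqxx mulr1n; apply/eqP; rewrite -subr_eq0 -[X in _ == X]h0; apply/eqP; ring.
- by rewrite (sq_border_r hS hT lS) no ?mem_cat ?lS // subr0.
- by rewrite bordered_sqC (sq_border_r hT hS lT) no ?mem_cat ?lT ?orbT // subr0.
- by rewrite (sq_border_l hS kS) eq_sym no ?mem_cat ?kS // subr0.
- exact: (sq_block hS hT kS lS).
- by rewrite (sq_cross hS hT kS lT) nST // subr0.
- by rewrite bordered_sqC (sq_border_l hT kT) eq_sym no ?mem_cat ?kT ?orbT // subr0.
- by rewrite bordered_sqC (sq_cross hT hS kT lS) eq_sym nST // subr0.
- by rewrite bordered_sqC; exact: (sq_block hT hS kT lT).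
Qed.

(** * Cauchy-like data and divided differences at its nodes *)

Lemma divdiff_map (F : fieldType) (I : eqType) (g : I -> F) (r : seq I) (s : seq F) :
  {in r &, injective g} ->
  divdiff (map g r) s =
  \sum_(i <- r) (\prod_(x <- s) (g i - x)) / (\prod_(j <- r | j != i) (g i - g j)).
Proof.
move=> gI; rewrite /divdiff big_map; apply: eq_big_seq => i ir; congr (_ / _).
rewrite big_map big_seq_cond [RHS]big_seq_cond; apply: eq_bigl => j.
by case: (boolP (j \in r)) => //= jr; rewrite (inj_in_eq gI).
Qed.

(** Isolating the node [i] exposes the factor [g k - g i]; with [i] taken from the opposite block it
    accounts for the squared gaps of [bh_sum3]. *)
Lemma divdiff_map_cons (F : fieldType) (I : eqType) (g : I -> F) i (r : seq I) (s : seq F) :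
  i \notin r -> {in i :: r &, injective g} ->
  divdiff (map g (i :: r)) s =
  (\prod_(x <- s) (g i - x)) / (\prod_(j <- r) (g i - g j)) +
  \sum_(k <- r) (\prod_(x <- s) (g k - x))
                / ((g k - g i) * \prod_(j <- r | j != k) (g k - g j)).
Proof.
move=> ir gI; rewrite divdiff_map // !big_cons eqxx /=.
have nir j : j \in r -> j != i by move=> jr; apply: contraNneq ir => <-.
congr (_ / _ + _).
  rewrite big_seq_cond [RHS]big_seq; apply: eq_bigl => j.
  by case: (boolP (j \in r)) => //= /nir.
by apply: eq_big_seq => k /nir ki; rewrite big_cons eq_sym ki.
Qed.

Section CauchyData.
Variables (F : numFieldType) (I : eqType) (M : I -> I -> F) (o : I).
Variables (S T : seq I) (g : I -> F) (a1 a2 b3 : F).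
Hypotheses (uST : uniq (o :: S ++ T)) (sizeT : size T = (size S).+1).
Hypotheses (S_gt0 : (0 < size S)%N) (gI : {in S ++ T &, injective g}).
Hypothesis diagS : {in S &, forall s s', M s s' = (a1 + a2 - b3 - g s) *+ (s == s')}.
Hypothesis diagT : {in T &, forall t t', M t t' = (b3 + g t) *+ (t == t')}.
Hypothesis Moo : M o o = a1 + a2 - b3 - \sum_(t <- T) g t + \sum_(s <- S) g s.
Hypothesis crossST : {in S & T, forall s t, M s t = - (M s o * M o t / (g t - g s))}.
Hypothesis crossTS : {in T & S, forall t s, M t s = - (M t o * M o s / (g t - g s))}.
Hypothesis weightS : {in S, forall s, M o s * M s o =
  - (\prod_(t <- T) (g s - g t) / \prod_(k <- S | k != s) (g s - g k))}.
Hypothesis weightT : {in T, forall t, M o t * M t o =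
  - ((g t - (a1 - b3)) * (g t - (a2 - b3)) * \prod_(s <- S) (g t - g s)
     / \prod_(k <- T | k != t) (g t - g k))}.

Let uS : uniq S. Proof. by move: uST; rewrite /= cat_uniq => /and4P[]. Qed.
Let uT : uniq T. Proof. by move: uST; rewrite /= cat_uniq => /and4P[]. Qed.
Let gIS : {in S &, injective g}.
Proof. by move=> x y xS yS; apply: gI; rewrite mem_cat ?xS ?yS. Qed.
Let gIT : {in T &, injective g}.
Proof. by move=> x y xS yS; apply: gI; rewrite mem_cat ?xS ?yS orbT. Qed.
Let ST_neq s t : s \in S -> t \in T -> s != t.
Proof.
move: uST => /= /andP[_]; rewrite cat_uniq => /and3P[_ /hasPn dST _] sS tT.
by apply: contraNneq (dST _ tT) => <-.
Qed.
Let gST s t : s \in S -> t \in T -> g t - g s != 0.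
Proof.
move=> sS tT; rewrite subr_eq0; apply/eqP => /esym E.
have := ST_neq sS tT; rewrite (gI _ _ E) ?eqxx // mem_cat ?sS ?tT ?orbT //.
Qed.
Let gapST s t : s \in S -> t \in T -> cross_gap M a1 a2 s t = g t - g s.
Proof. by move=> sS tT; rewrite /cross_gap diagS // diagT // !eqxx !mulr1n; ring. Qed.
Let gapTS s t : s \in S -> t \in T -> cross_gap M a1 a2 t s = g t - g s.
Proof. by move=> sS tT; rewrite cross_gapC gapST. Qed.
Let umS : uniq (map g S). Proof. by rewrite map_inj_in_uniq. Qed.
Let umT : uniq (map g T). Proof. by rewrite map_inj_in_uniq. Qed.
(** The weights on [T] are minus the divided-difference terms for the roots [roots S], those on [S]
    minus the terms for the roots [map g T]. In both cases there is one root more than nodes. *)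
Let roots s := (a1 - b3) :: (a2 - b3) :: map g s.
Let gIS_T s : s \in S -> {in s :: T &, injective g}.
Proof.
move=> sS x y; rewrite !inE => xT yT; apply: gI; rewrite mem_cat.
  by case/orP: xT => [/eqP->|->]; rewrite ?sS ?orbT.
by case/orP: yT => [/eqP->|->]; rewrite ?sS ?orbT.
Qed.
Let gIT_S t : t \in T -> {in t :: S &, injective g}.
Proof.
move=> sS x y; rewrite !inE => xT yT; apply: gI; rewrite mem_cat.
  by case/orP: xT => [/eqP->|->]; rewrite ?sS ?orbT.
by case/orP: yT => [/eqP->|->]; rewrite ?sS ?orbT.
Qed.
Let prod_neq0 r i : {in r, forall j, j != i -> g i != g j} ->
  \prod_(j <- r | j != i) (g i - g j) != 0.
Proof.
move=> h; rewrite big_seq_cond prodf_seq_neq0; apply/allP => j jr.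
by apply/implyP => /andP[_ ji]; rewrite subr_eq0 h.
Qed.
Let wS0 s : s \in S -> \prod_(j <- S | j != s) (g s - g j) != 0.
Proof. by move=> sS; apply: prod_neq0 => j jS; rewrite (inj_in_eq gIS) // eq_sym. Qed.
Let wT0 s : s \in T -> \prod_(j <- T | j != s) (g s - g j) != 0.
Proof. by move=> sS; apply: prod_neq0 => j jS; rewrite (inj_in_eq gIT) // eq_sym. Qed.
Let prod_rem r i : uniq r ->
  \prod_(j <- rem i r) (g i - g j) = \prod_(j <- r | j != i) (g i - g j).
Proof. by move=> ur; rewrite rem_filter // big_filter. Qed.

(** Dividing a weight of [t] by the gap [g t - g s] removes the root [g s], so each required sum is
    a divided difference with fewer roots. *)
Lemma cauchy_half_S : bordered_half M o a1 a2 S T.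
Proof.
split=> //.
- by move=> s s' sS s'S ss'; rewrite diagS // (negPf ss').
- by move=> s t sS tT; rewrite gapST // gST.
- by move=> s t sS tT; rewrite gapST // crossST.
- move=> s sS.
  (* One root removed: as many roots as nodes. *)
  have -> : \sum_(t <- T) loop_weight M o t / cross_gap M a1 a2 s t =
      - divdiff (map g T) (roots (rem s S)).
    rewrite divdiff_map // -sumrN; apply: eq_big_seq => t tT.
    rewrite gapST // /loop_weight weightT // !big_cons big_map (big_rem s sS) /=.
    by field; rewrite wT0 // gST.
  rewrite divdiff_eq_size //=; last by rewrite !size_map size_rem // sizeT; lia.
  rewrite Moo diagS // eqxx mulr1n !big_cons !big_map [\sum_(s <- S) _](big_rem s sS) /=.
  by ring.
- move=> s s' sS s'S ss'.
  have s'r : s' \in rem s S by rewrite mem_rem_uniq // !inE eq_sym ss'.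
  have sz : (1 < size S)%N.
    by case: (S) sS s'r => [|x [|y r]] //; rewrite !inE /= => /eqP->; rewrite eqxx.
  (* Two roots removed: one root fewer than nodes, hence the value 1. *)
  rewrite -(@divdiff_monic _ (map g T) (roots (rem s' (rem s S)))) //; last first.
    by rewrite /= !size_map !size_rem // sizeT; lia.
  rewrite divdiff_map // -sumrN; apply: eq_big_seq => t tT.
  rewrite !gapST // /loop_weight weightT // !big_cons big_map.
  rewrite (big_rem s sS) /= (big_rem s' s'r) /=.
  by field; rewrite wT0 // !gST.
- move=> s sS.
  have snT : s \notin T by apply/negP => sT; have := ST_neq sS sT; rewrite eqxx.
  (* A squared gap removes the root [g s] and leaves one factor in the denominator, which amounts to
     adjoining [g s] as a node. *)
  have := @divdiff_monic _ (map g (s :: T)) (roots (rem s S)).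
  rewrite map_inj_in_uniq /= ?snT //; last exact: gIS_T.
  rewrite !size_map size_rem // sizeT => /(_ uT) H.
  have {}/H : (size S).+2 = (size S).-1.+3 by lia.
  rewrite -map_cons divdiff_map_cons //; last exact: gIS_T.
  set X := \sum_(_ <- _) _ => H.
  have -> : \sum_(t <- T) loop_weight M o t / cross_gap M a1 a2 s t ^+ 2 = - X.
    rewrite -sumrN; apply: eq_big_seq => t tT.
    rewrite gapST // /loop_weight weightT // !big_cons big_map (big_rem s sS) /=.
    by field; rewrite wT0 // gST.
  have {H} -> : X = 1 - (\prod_(x <- roots (rem s S)) (g s - x)
                         / \prod_(j <- T) (g s - g j)) 
    by apply/eqP; rewrite eq_sym subr_eq addrC H.
  (* The weight of [s] times the term of the adjoined node is minus the product of [g s - (a1 - b3)]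
     and [g s - (a2 - b3)], which equals minus that of [M s s - a1] and [M s s - a2]. *)
  rewrite /loop_weight weightS // diagS // eqxx mulr1n !big_cons big_map prod_rem //.
  field; rewrite wS0 // andbT prodf_seq_neq0; apply/allP => t tT.
  by rewrite /= -oppr_eq0 opprB gST.
Qed.

(** The same cancellations with roots [map g T]. The gap is now opposite to the removed factor
    [g s - g t], whence the change of sign in the first sum; the two factors with [a1] and [a2] come
    from the weight of [t]. *)
Lemma cauchy_half_T : bordered_half M o a1 a2 T S.
Proof.
split=> //.
- by move=> s s' sS s'S ss'; rewrite diagT // (negPf ss').
- by move=> t s tT sS; rewrite gapTS // gST.
- by move=> t s tT sS; rewrite gapTS // crossTS.
- move=> t tT.
  have -> : \sum_(s <- S) loop_weight M o s / cross_gap M a1 a2 t s =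
      divdiff (map g S) (map g (rem t T)).
    rewrite divdiff_map //; apply: eq_big_seq => s sS.
    rewrite gapTS // /loop_weight weightS // big_map (big_rem t tT) /=.
    by field; rewrite wS0 // gST.
  rewrite divdiff_eq_size //=; last by rewrite !size_map size_rem // sizeT.
  rewrite Moo diagT // eqxx mulr1n !big_map [\sum_(s <- T) _](big_rem t tT) /=.
  by ring.
- move=> t t' tT t'T tt'.
  have t'r : t' \in rem t T by rewrite mem_rem_uniq // !inE eq_sym tt'.
  rewrite -(@divdiff_monic _ (map g S) (map g (rem t' (rem t T)))) //; last first.
    by rewrite /= !size_map !size_rem // sizeT; lia.
  rewrite divdiff_map // -sumrN; apply: eq_big_seq => s sS.
  rewrite !gapTS // /loop_weight weightS // big_map.
  rewrite (big_rem t tT) /= (big_rem t' t'r) /=.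
  by field; rewrite wS0 // !gST.
- move=> t tT.
  have tnS : t \notin S by apply/negP => tS; have := ST_neq tS tT; rewrite eqxx.
  have := @divdiff_monic _ (map g (t :: S)) (map g (rem t T)).
  rewrite map_inj_in_uniq /= ?tnS //; last exact: gIT_S.
  rewrite !size_map size_rem // sizeT => /(_ uS erefl).
  rewrite -map_cons divdiff_map_cons //; last exact: gIT_S.
  set X := \sum_(_ <- _) _ => H.
  have -> : \sum_(s <- S) loop_weight M o s / cross_gap M a1 a2 t s ^+ 2 = - X.
    rewrite -sumrN; apply: eq_big_seq => s sS.
    rewrite gapTS // /loop_weight weightS // big_map (big_rem t tT) /=.
    by field; rewrite wS0 // -[g s - _]opprB oppr_eq0 gST.
  have {H} -> : X = 1 - (\prod_(x <- map g (rem t T)) (g t - x)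
                         / \prod_(j <- S) (g t - g j)) 
    by apply/eqP; rewrite eq_sym subr_eq addrC H.
  rewrite /loop_weight weightT // diagT // eqxx mulr1n big_map prod_rem //.
  field; rewrite wT0 // andbT prodf_seq_neq0; apply/allP => s sS.
  by rewrite /= gST.
Qed.

(** Both sums are divided differences with one root more than nodes. In their doubled values the
    squares of the nodes cancel, and [Moo] matches the rest. *)
Lemma cauchy_border : (M o o - a1) * (M o o - a2)
  + \sum_(s <- S) M o s * M s o + \sum_(t <- T) M o t * M t o = 0.
Proof.
have -> : \sum_(s <- S) M o s * M s o = - divdiff (map g S) (map g T).
  rewrite divdiff_map // -sumrN; apply: eq_big_seq => s sS.
  by rewrite weightS // big_map.
have -> : \sum_(t <- T) M o t * M t o = - divdiff (map g T) (roots S).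
  rewrite divdiff_map // -sumrN; apply: eq_big_seq => t tT.
  by rewrite weightT // !big_cons big_map mulrA.
apply: (@mulfI _ 2); first by rewrite pnatr_eq0.
rewrite mulr0 !mulrDr !mulrN !divdiff_succ_size //=; last first.
- by rewrite !size_map sizeT.
- by rewrite !size_map sizeT.
by rewrite !big_cons !big_map Moo; ring.
Qed.

Lemma cauchy_square : {in o :: S ++ T &, forall k l,
  \sum_(j <- o :: S ++ T) M k j * M j l =
  (a1 + a2) * M k l - (a1 * a2) *+ (k == l)}.
Proof.
exact: (bordered_square cauchy_half_S cauchy_half_T uST cauchy_border).
Qed.

End CauchyData.

(** * Entries of the even family in reversed order *)

Lemma prod_nat_neq (F : fieldType) (lo hi x : nat) (f : nat -> F) :
  (lo <= x < hi)%N ->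
  \prod_(lo <= k < hi | k != x) f k =
  \prod_(lo <= k < x) f k * \prod_(x.+1 <= k < hi) f k.
Proof.
case/andP=> lox xhi; rewrite (big_cat_nat lox (ltnW xhi)) /=.
rewrite (big_ltn_cond xhi) eqxx /=; congr (_ * _);
  rewrite big_nat_cond [RHS]big_nat; apply: eq_bigl => k; lia.
Qed.

Lemma Prx_in (F : fieldType) (lo hi x : nat) (f : nat -> F) :
  (lo <= x <= hi)%N -> f x != 0 -> Prx lo hi x f = Pr lo hi f / f x.
Proof.
move=> xin fx0; rewrite /Prx /Pr prod_nat_neq; last by lia.
rewrite [in RHS](@big_cat_nat _ _ _ x) /=; [|lia|lia].
by rewrite [\prod_(x <= k < _) _]big_ltn; [field|lia].
Qed.

Lemma Prx_out (F : fieldType) (lo hi x : nat) (f : nat -> F) :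
  ~~ (lo <= x <= hi)%N -> Prx lo hi x f = Pr lo hi f.
Proof.
move=> xout; rewrite /Prx /Pr big_nat_cond [RHS]big_nat; apply: eq_bigl => k; lia.
Qed.

Lemma prod_natN (F : fieldType) (lo hi : nat) (f : nat -> F) :
  \prod_(lo <= k < hi) - f k = (-1) ^+ (hi - lo) * \prod_(lo <= k < hi) f k.
Proof.
rewrite -prodr_const_nat -big_split /=.
by apply: eq_bigr => k _; rewrite mulN1r.
Qed.

Ltac eval_ifs :=
  repeat first [rewrite ifT; last by lia | rewrite ifF; last by lia].

Section Entries.
Variables (F : fieldType) (m : nat) (a1 a2 b1 b2 b3 : F) (c : nat -> F).
Local Notation q := (qq a1 a2 b2 b3 c).
Local Notation p1 := (p31 a1 b3 c).
Local Notation p2 := (p32 a2 b3 c).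

(* Reversing the order of rows and columns aligns them with the indices of c. *)
Definition Arev (k l : nat) : F :=
  Bent m a1 a2 b1 b2 b3 c (2 * m + 1 - k) (2 * m + 1 - l)
  + Cent m a1 a2 b2 b3 c (2 * m + 1 - k) (2 * m + 1 - l).

Lemma Arev_oo : (0 < m)%N -> Arev (2 * m) (2 * m) = b1 + c (2 * m).
Proof.
move=> m_gt0; rewrite /Arev /Bent /Cent; eval_ifs => //.
Qed.

Lemma Arev_SS s s' : (m < s < 2 * m)%N -> (m < s' < 2 * m)%N ->
  Arev s s' = (b2 + c s) *+ (s == s').
Proof.
move=> hs hs'; rewrite /Arev /Bent /Cent; have [<-|ss'] := eqVneq s s'.
  by eval_ifs; rewrite (_ : 2 * m - _ = s)%N //; lia.
by eval_ifs; rewrite addr0.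
Qed.

Lemma Arev_TT t t' : (0 < t <= m)%N -> (0 < t' <= m)%N ->
  Arev t t' = (b3 + c t) *+ (t == t').
Proof.
move=> ht ht'; rewrite /Arev /Bent /Cent; have [<-|tt'] := eqVneq t t'.
  by eval_ifs; rewrite (_ : m + 1 - _ = t)%N //; lia.
by eval_ifs; rewrite addr0.
Qed.

Lemma Arev_oS s : (m < s < 2 * m)%N ->
  Arev (2 * m) s = (-1) ^+ (s + 1 - m)
    * (\prod_((2 * m - s).+1 <= k < m.+1) q k s)
    / \prod_(m.+1 <= k < s) (c k - c s).
Proof.
move=> hs; rewrite /Arev /Bent /Cent; eval_ifs; rewrite addr0 /sgn /Pr.
rewrite (_ : 2 * m - (2 * m + 1 - s - 1) = s)%N; last by lia.
rewrite (_ : 2 * m + 1 - s - 1 = 2 * m - s)%N; last by lia.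
rewrite (_ : m + 1 - (2 * m - s) = s + 1 - m)%N; last by lia.
by rewrite (_ : (2 * m - 1 - (2 * m - s)).+1 = s)%N //; lia.
Qed.

Lemma Arev_So s : (m < s < 2 * m)%N ->
  Arev s (2 * m) = - ((\prod_(1 <= k < (2 * m - s).+1) q k s)
    / \prod_(s.+1 <= k < 2 * m) (c s - c k)).
Proof.
move=> hs; rewrite /Arev /Bent /Cent; eval_ifs; rewrite add0r /Pr.
rewrite (_ : 2 * m - (2 * m + 1 - s - 1) = s)%N; last by lia.
rewrite (_ : 2 * m + 1 - s - 1 = 2 * m - s)%N; last by lia.
rewrite (_ : (2 * m - 1).+1 = 2 * m)%N; last by lia.
by rewrite (_ : 2 * m + 1 - (2 * m - s) = s.+1)%N //; lia.
Qed.

Lemma Arev_oT t : (0 < t <= m)%N ->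
  Arev (2 * m) t = (-1) ^+ t.-1 * p1 t
    * (\prod_((2 * m - t).+1 <= k < 2 * m) q t k)
    / \prod_(1 <= k < t) (c k - c t).
Proof.
move=> ht; rewrite /Arev /Bent /Cent; eval_ifs; rewrite addr0 /sgn /Pr.
rewrite (_ : 2 * m + 1 - t - m = m + 1 - t)%N; last by lia.
rewrite (_ : m + 1 - (m + 1 - t) = t)%N; last by lia.
rewrite (_ : m - (m + 1 - t) = t.-1)%N; last by lia.
rewrite (_ : m + (m + 1 - t) = (2 * m - t).+1)%N; last by lia.
rewrite (_ : (2 * m - 1).+1 = 2 * m)%N; last by lia.
by rewrite prednK //; lia.
Qed.

Lemma Arev_To t : (0 < t <= m)%N ->
  Arev t (2 * m) = - (p2 t * (\prod_(m.+1 <= k < (2 * m - t).+1) q t k)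
    / \prod_(t.+1 <= k < m.+1) (c t - c k)).
Proof.
move=> ht; rewrite /Arev /Bent /Cent; eval_ifs; rewrite add0r /Pr.
rewrite (_ : 2 * m + 1 - t - m = m + 1 - t)%N; last by lia.
rewrite (_ : m + 1 - (m + 1 - t) = t)%N; last by lia.
rewrite (_ : m + 2 - (m + 1 - t) = t.+1)%N; last by lia.
by rewrite (_ : m - 1 + (m + 1 - t) = 2 * m - t)%N //; lia.
Qed.

(** The factor [q t s] is omitted from exactly one of the two restricted products: from the first if
    t + s is at most 2m, from the second otherwise. Either way the omission is a single division by
    [q t s]. *)
Lemma Arev_ST s t : (m < s < 2 * m)%N -> (0 < t <= m)%N -> q t s != 0 ->
  Arev s t = - (Arev s (2 * m) * Arev (2 * m) t / q t s).
Proof.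
move=> hs ht q0; rewrite Arev_So // Arev_oT // /Arev /Bent /Cent; eval_ifs.
rewrite addr0 /sgn.
rewrite (_ : 2 * m + 1 - t - m = m + 1 - t)%N; last by lia.
rewrite (_ : m + 1 - (m + 1 - t) = t)%N; last by lia.
rewrite (_ : m - (m + 1 - t) = t.-1)%N; last by lia.
rewrite (_ : m + (m + 1 - t) = (2 * m - t).+1)%N; last by lia.
rewrite (_ : 2 * m - (2 * m + 1 - s - 1) = s)%N; last by lia.
rewrite (_ : 2 * m + 1 - s - 1 = 2 * m - s)%N; last by lia.
rewrite (_ : 2 * m + 1 - (2 * m - s) = s.+1)%N; last by lia.
have -> : Prx 1 (2 * m - s) t (q^~ s) * Prx (2 * m - t).+1 (2 * m - 1) s (q t) =
    Pr 1 (2 * m - s) (q^~ s) * Pr (2 * m - t).+1 (2 * m - 1) (q t) / q t s.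
  have [le|gt] := leqP t (2 * m - s).
    rewrite Prx_in //; last by lia.
    by rewrite Prx_out; [rewrite mulrAC | lia].
  rewrite Prx_out; last by lia.
  by rewrite Prx_in //; [rewrite mulrA | lia].
rewrite /Pr (_ : (2 * m - 1).+1 = 2 * m)%N; last by lia.
rewrite prednK; last by lia.
by rewrite !invfM; ring.
Qed.

Lemma Arev_TS t s : (0 < t <= m)%N -> (m < s < 2 * m)%N -> q t s != 0 ->
  Arev t s = - (Arev t (2 * m) * Arev (2 * m) s / q t s).
Proof.
move=> ht hs q0; rewrite Arev_To // Arev_oS // /Arev /Bent /Cent; eval_ifs.
rewrite add0r /sgn.
rewrite (_ : 2 * m + 1 - t - m = m + 1 - t)%N; last by lia.
rewrite (_ : m + 1 - (m + 1 - t) = t)%N; last by lia.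
rewrite (_ : m + 2 - (m + 1 - t) = t.+1)%N; last by lia.
rewrite (_ : m - 1 + (m + 1 - t) = 2 * m - t)%N; last by lia.
rewrite (_ : 2 * m - (2 * m + 1 - s - 1) = s)%N; last by lia.
rewrite (_ : 2 * m + 1 - s - 1 = 2 * m - s)%N; last by lia.
rewrite (_ : m + 1 - (2 * m - s) = s + 1 - m)%N; last by lia.
have -> : Prx m.+1 (2 * m - t) s (q t) * Prx (2 * m - s).+1 m t (q^~ s) =
    Pr m.+1 (2 * m - t) (q t) * Pr (2 * m - s).+1 m (q^~ s) / q t s.
  have [le|gt] := leqP t (2 * m - s).
    rewrite Prx_in //; last by lia.
    by rewrite Prx_out; [rewrite mulrAC | lia].
  rewrite Prx_out; last by lia.
  by rewrite Prx_in //; [rewrite mulrA | lia].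
rewrite /Pr (_ : (2 * m - 1 - (2 * m - s)).+1 = s)%N; last by lia.
by rewrite !invfM; ring.
Qed.

(* With these nodes the q's become differences: [q t s = node t - node s]. *)
Definition node (k : nat) : F :=
  if (k <= m)%N then c k else - (c k + b2 + b3 - a1 - a2).

Lemma nodeT t : (t <= m)%N -> node t = c t. Proof. by rewrite /node => ->. Qed.

Lemma nodeS s : (m < s)%N -> node s = - (c s + b2 + b3 - a1 - a2).
Proof. by rewrite /node ltnNge => /negPf->. Qed.

Lemma node_sub t s : (t <= m < s)%N -> node t - node s = q t s.
Proof. by case/andP=> tm ms; rewrite nodeT // nodeS // /qq; ring. Qed.

(** The numerators of the two border entries run over complementary parts of 1..m, split at 2m - s,
    and the denominators over the indices of the block below and above [s]. *)
Lemma Arev_weightS s : (m < s < 2 * m)%N ->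
  Arev (2 * m) s * Arev s (2 * m) =
  - (\prod_(1 <= t < m.+1) (node s - node t)
     / \prod_(m.+1 <= k < 2 * m | k != s) (node s - node k)).
Proof.
move=> hs; rewrite Arev_oS // Arev_So // prod_nat_neq; last by lia.
have -> : \prod_(1 <= t < m.+1) (node s - node t) =
    (-1) ^+ (m.+1 - 1) * \prod_(1 <= t < m.+1) q t s.
  rewrite -prod_natN.
  by apply: eq_big_nat => t ht; rewrite -node_sub ?opprB //; lia.
rewrite [\prod_(1 <= t < m.+1) q t s](@big_cat_nat _ _ _ (2 * m - s).+1) /=; [|lia|lia].
have -> : \prod_(m.+1 <= k < s) (node s - node k) = \prod_(m.+1 <= k < s) (c k - c s).
  by apply: eq_big_nat => k hk; rewrite !nodeS; [ring|lia|lia].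
have -> : \prod_(s.+1 <= k < 2 * m) (node s - node k) =
    (-1) ^+ (2 * m - s.+1) * \prod_(s.+1 <= k < 2 * m) (c s - c k).
  rewrite -prod_natN; apply: eq_big_nat => k hk; rewrite !nodeS; [ring|lia|lia].
(* Of the m signs from [node s - node t], s + 1 - m form the sign in [Arev_oS] and the others cancel
   those of the denominator factors above [s]. *)
rewrite (_ : m.+1 - 1 = (s + 1 - m) + (2 * m - s.+1))%N; last by lia.
rewrite exprD !invfM.
have E : (-1) ^+ (2 * m - s.+1) / (-1) ^+ (2 * m - s.+1) = 1 :> F.
  by rewrite divff // signr_eq0.
by rewrite -[LHS]mulr1 -[X in _ * X]E; ring.
Qed.

(** Again complementary ranges are joined; [p1 t] and [p2 t] provide the two extra roots [a1 - b3]
    and [a2 - b3], and the sign turns the factors below [t]. *)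
Lemma Arev_weightT t : (0 < t <= m)%N ->
  Arev (2 * m) t * Arev t (2 * m) =
  - ((node t - (a1 - b3)) * (node t - (a2 - b3))
       * \prod_(m.+1 <= s < 2 * m) (node t - node s)
     / \prod_(1 <= k < m.+1 | k != t) (node t - node k)).
Proof.
move=> ht; rewrite Arev_oT // Arev_To // prod_nat_neq; last by lia.
have -> : \prod_(m.+1 <= s < 2 * m) (node t - node s) =
    \prod_(m.+1 <= s < 2 * m) q t s.
  by apply: eq_big_nat => s hs; rewrite -node_sub //; lia.
rewrite [\prod_(m.+1 <= s < 2 * m) q t s](@big_cat_nat _ _ _ (2 * m - t).+1) /=;
  [|lia|lia].
have -> : \prod_(t.+1 <= k < m.+1) (node t - node k) =
    \prod_(t.+1 <= k < m.+1) (c t - c k).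
  by apply: eq_big_nat => k hk; rewrite !nodeT //; lia.
have -> : \prod_(1 <= k < t) (node t - node k) =
    (-1) ^+ (t - 1) * \prod_(1 <= k < t) (c k - c t).
  by rewrite -prod_natN; apply: eq_big_nat => k hk; rewrite !nodeT ?opprB //; lia.
rewrite nodeT; last by lia.
rewrite subn1 !invfM invr_sign.
rewrite /p31 /p32; ring.
Qed.

End Entries.

(** * The quadratic equation when no q vanishes *)

Section EvenFamily.
Variables (F : numFieldType) (m : nat) (a1 a2 b3 : F) (c : nat -> F).
Hypothesis m_ge2 : (2 <= m)%N.
Hypothesis c_inj : forall i j : nat, (1 <= i <= 2 * m)%N -> (1 <= j <= 2 * m)%N ->
  i != j -> c i != c j.

Local Notation S := (index_iota m.+1 (2 * m)).
Local Notation T := (index_iota 1 m.+1).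

Local Notation A b1 b2 := (Bmx m a1 a2 b1 b2 b3 c + Cmx m a1 a2 b2 b3 c).

Definition trace_condition b1 b2 := m%:R * a1 + m%:R * a2
  = b1 + (m - 1)%:R * b2 + m%:R * b3 + \sum_(1 <= i < (2 * m).+1) c i.

Lemma Arev_square b1 b2 : trace_condition b1 b2 ->
  (forall t s, (0 < t <= m)%N -> (m < s < 2 * m)%N -> qq a1 a2 b2 b3 c t s != 0) ->
  {in (2 * m)%N :: S ++ T &, forall k l,
    \sum_(j <- (2 * m)%N :: S ++ T)
      Arev m a1 a2 b1 b2 b3 c k j * Arev m a1 a2 b1 b2 b3 c j l =
    (a1 + a2) * Arev m a1 a2 b1 b2 b3 c k l - (a1 * a2) *+ (k == l)}.
Proof.
move=> tr q0.
have inS s : s \in S -> (m < s < 2 * m)%N by rewrite mem_index_iota.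
have inT t : t \in T -> (0 < t <= m)%N by rewrite mem_index_iota.
have neq_c i j : (1 <= i <= 2 * m)%N -> (1 <= j <= 2 * m)%N -> c i = c j -> i = j.
  move=> hi hj cij; apply/eqP; apply/negPn/negP => ij.
  by have := c_inj hi hj ij; rewrite cij eqxx.
apply: (@cauchy_square _ _ _ _ S T (node m a1 a2 b2 b3 c) a1 a2 b3).
- rewrite /= mem_cat !mem_index_iota cat_uniq !iota_uniq andbT.
  by apply/andP; split; [lia | apply/hasPn => t /inT ht; rewrite mem_index_iota; lia].
- by rewrite !size_iota; lia.
- by rewrite size_iota; lia.
(* Nodes of different blocks are distinct exactly because [q t s] is nonzero; within a block the
   distinctness of the c's suffices. *)
- have cross t s : t \in T -> s \in S ->
      node m a1 a2 b2 b3 c t <> node m a1 a2 b2 b3 c s.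
    move=> /inT ht /inS hs E; have := q0 t s ht hs.
    by rewrite -(@node_sub _ m) ?E ?subrr ?eqxx //; lia.
  move=> x y; rewrite !mem_cat => /orP[xS|xT] /orP[yS|yT] E.
  + have hx := inS _ xS; have hy := inS _ yS; apply: neq_c; [lia|lia|].
    move: E; rewrite !nodeS; [|lia|lia].
    by move=> /oppr_inj /addIr /addIr /addIr /addIr.
  + by case: (cross y x yT xS).
  + by case: (cross x y xT yS).
  + have hx := inT _ xT; have hy := inT _ yT; apply: neq_c; [lia|lia|].
    by move: E; rewrite !nodeT //; lia.
- move=> s s' /inS hs /inS hs'; rewrite Arev_SS // nodeS; last by lia.
  by congr (_ *+ _); ring.
- move=> t t' /inT ht /inT ht'; rewrite Arev_TT // nodeT //; lia.
(* The prescribed corner value is the trace condition rewritten in nodes, [S] having m - 1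
   elements. *)
- rewrite Arev_oo; last by lia.
  have -> : \sum_(t <- T) node m a1 a2 b2 b3 c t = \sum_(t <- T) c t.
    by apply: eq_big_seq => t /inT ht; rewrite nodeT //; lia.
  have -> : \sum_(s <- S) node m a1 a2 b2 b3 c s =
      - \sum_(s <- S) c s - (m%:R - 1) * (b2 + b3 - a1 - a2).
    rewrite -sumrN (_ : m%:R - 1 = (2 * m - m.+1)%:R); last first.
      by rewrite -(natrB _ (ltnW m_ge2)); congr (_%:R); lia.
    rewrite mulr_natl -sumr_const_nat -sumrB.
    by apply: eq_big_seq => s /inS hs; rewrite nodeS; [ring | lia].
  move: tr; rewrite /trace_condition big_nat_recr; last by lia.
  rewrite (@big_cat_nat _ _ _ m.+1) /=; [|lia|lia].
  rewrite  natrB; last by lia.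
  move=> E; apply/eqP; rewrite -subr_eq0; apply/eqP.
  transitivity ((b1 + (m%:R - 1) * b2 + m%:R * b3 + (\sum_(t <- T) c t +
     \sum_(s <- S) c s + c (2 * m)%N)) - (m%:R * a1 + m%:R * a2)); first by ring.
  by rewrite -E subrr.
- move=> s t /inS hs /inT ht; rewrite node_sub; last by lia.
  by apply: Arev_ST => //; exact: q0.
- move=> t s /inT ht /inS hs; rewrite node_sub; last by lia.
  by apply: Arev_TS => //; exact: q0.
- by move=> s /inS hs; exact: Arev_weightS.
- by move=> t /inT ht; exact: Arev_weightT.
Qed.

Lemma even_family_square_generic b1 b2 : trace_condition b1 b2 ->
  (forall t s, (0 < t <= m)%N -> (m < s < 2 * m)%N -> qq a1 a2 b2 b3 c t s != 0) ->
  A b1 b2 *m A b1 b2 = (a1 + a2) *: A b1 b2 - (a1 * a2)%:M.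
Proof.
move=> tr q0; have sq := Arev_square tr q0.
have AE (i j : 'I_(2 * m)) :
    A b1 b2 i j = Arev m a1 a2 b1 b2 b3 c (2 * m - i) (2 * m - j).
  have rev (k : 'I_(2 * m)) : (2 * m + 1 - (2 * m - k) = k.+1)%N.
    by have := ltn_ord k; lia.
  by rewrite !mxE /Arev !rev.
have memST k : (k \in 2 * m :: S ++ T)%N = (0 < k <= 2 * m)%N.
  by rewrite inE mem_cat !mem_index_iota; lia.
(* The ordinal [i] stands for row i + 1, whose reversed index is 2m - i. *)
have perm : perm_eq (2 * m :: S ++ T)%N [seq (2 * m - i)%N | i <- index_iota 0 (2 * m)].
  apply: uniq_perm.
  - rewrite /= mem_cat !mem_index_iota cat_uniq !iota_uniq andbT.
    apply/andP; split; first by lia.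
    by apply/hasPn => t; rewrite !mem_index_iota; lia.
  - rewrite map_inj_in_uniq ?iota_uniq // => x y.
    by rewrite !mem_index_iota; lia.
  - move=> k; rewrite memST; apply/idP/mapP => [hk|[x]].
      by exists (2 * m - k)%N; [rewrite mem_index_iota; lia | lia].
    by rewrite mem_index_iota => hi ->; lia.
apply/matrixP => i j; rewrite [RHS]mxE [in RHS]mxE [(- _%:M) i j]mxE [(_%:M) i j]mxE.
rewrite [LHS]mxE AE.
have := ltn_ord i; have := ltn_ord j => hj hi.
have -> : (i == j) = ((2 * m - i) == (2 * m - j))%N by rewrite -val_eqE /=; lia.
rewrite -sq ?memST; [|lia|lia].
rewrite (perm_big _ perm) big_map big_mkord.
by apply: eq_bigr => k _; rewrite !AE.
Qed.

End EvenFamily.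

(** * Functions polynomial in one parameter *)

Section PolynomialFunctions.
Variable F : numFieldType.
Implicit Types f g : F -> F.

Definition polyfun f := exists p : {poly F}, forall e, f e = p.[e].

Lemma polyfun_cst (x : F) : polyfun (fun=> x).
Proof. by exists x%:P => e; rewrite hornerC. Qed.

Lemma polyfun_id : polyfun id.
Proof. by exists 'X => e; rewrite hornerX. Qed.

Lemma polyfunD f g : polyfun f -> polyfun g -> polyfun (fun e => f e + g e).
Proof. by move=> [p pE] [r rE]; exists (p + r) => e; rewrite hornerD pE rE. Qed.

Lemma polyfunN f : polyfun f -> polyfun (fun e => - f e).
Proof. by move=> [p pE]; exists (- p) => e; rewrite hornerN pE. Qed.

Lemma polyfunM f g : polyfun f -> polyfun g -> polyfun (fun e => f e * g e).
Proof. by move=> [p pE] [r rE]; exists (p * r) => e; rewrite hornerM pE rE. Qed.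

Lemma polyfun_if (b : bool) f g :
  polyfun f -> polyfun g -> polyfun (fun e => if b then f e else g e).
Proof. by case: b. Qed.

Lemma polyfun_prod (I : Type) (r : seq I) (P : pred I) (h : I -> F -> F) :
  (forall i, polyfun (h i)) -> polyfun (fun e => \prod_(i <- r | P i) h i e).
Proof.
move=> hP; elim: r => [|i r [p pE]].
  by exists 1 => e; rewrite big_nil hornerC.
have [s sE] := hP i; exists (if P i then s * p else p) => e.
by rewrite big_cons pE sE; case: (P i); rewrite ?hornerM.
Qed.

Lemma polyfun_sum (I : Type) (r : seq I) (P : pred I) (h : I -> F -> F) :
  (forall i, polyfun (h i)) -> polyfun (fun e => \sum_(i <- r | P i) h i e).
Proof.
move=> hP; elim: r => [|i r [p pE]].
  by exists 0 => e; rewrite big_nil horner0.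
have [s sE] := hP i; exists (if P i then s + p else p) => e.
by rewrite big_cons pE sE; case: (P i); rewrite ?hornerD.
Qed.

(** Multiplying by the polynomial [w] with roots [bad] gives a polynomial vanishing at every point
    of an infinite field. *)
Lemma polyfun_eq0 f (bad : seq F) :
  polyfun f -> (forall e, e \notin bad -> f e = 0) -> forall e, f e = 0.
Proof.
move=> [p pE] f0 e; rewrite pE; suff -> : p = 0 by rewrite horner0.
pose w := \prod_(x <- bad) ('X - x%:P).
have w0 : w != 0 by rewrite monic_neq0 // monic_prod_XsubC.
suff /eqP : p * w = 0 by rewrite mulf_eq0 (negPf w0) orbF => /eqP.
apply/eqP/negPn/negP => nz.
(* Natural numbers are distinct in characteristic zero, so they supply as many roots as the size of
   [p * w], one too many. *)
pose rs : seq F := [seq i%:R | i <- iota 0 (size (p * w))].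
have /(max_poly_roots nz) : all (root (p * w)) rs.
  apply/allP => x _; rewrite rootM; have [xb|xb] := boolP (x \in bad).
    by rewrite root_prod_XsubC xb orbT.
  by rewrite rootE -pE f0 // eqxx.
rewrite map_inj_uniq ?iota_uniq; last by move=> i j /eqP; rewrite eqr_nat => /eqP.
by rewrite size_map size_iota ltnn => /(_ isT).
Qed.

End PolynomialFunctions.

(** * Shifting b2 to remove the genericity assumption, and the trace *)

Section Perturbation.
Variables (F : numFieldType) (m : nat) (a1 a2 b1 b2 b3 : F) (c : nat -> F).

(** All denominators are products of differences of c's, hence constant in [e]. *)
Lemma polyfun_entry (n : F) (i j : 'I_(2 * m)) : polyfun (fun e =>
  (Bmx m a1 a2 (b1 - n * e) (b2 + e) b3 c + Cmx m a1 a2 (b2 + e) b3 c) i j).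
Proof.
have [pB pBE] : polyfun (fun e => Bent m a1 a2 (b1 - n * e) (b2 + e) b3 c i.+1 j.+1).
  rewrite /Bent /Pr /Prx /qq.
  by repeat first [exact: polyfun_cst | exact: polyfun_id | apply: polyfun_if
    | apply: polyfunD | apply: polyfunN | apply: polyfunM | apply: polyfun_prod => ?].
have [pC pCE] : polyfun (fun e => Cent m a1 a2 (b2 + e) b3 c i.+1 j.+1).
  rewrite /Cent /Pr /Prx /qq.
  by repeat first [exact: polyfun_cst | exact: polyfun_id | apply: polyfun_if
    | apply: polyfunD | apply: polyfunN | apply: polyfunM | apply: polyfun_prod => ?].
by exists (pB + pC) => e; rewrite hornerD -pBE -pCE !mxE.
Qed.

Hypothesis m_ge2 : (2 <= m)%N.
Hypothesis c_inj : forall i j : nat, (1 <= i <= 2 * m)%N -> (1 <= j <= 2 * m)%N ->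
  i != j -> c i != c j.
Local Notation A := (Bmx m a1 a2 b1 b2 b3 c + Cmx m a1 a2 b2 b3 c).

(* Moving b2 by e shifts every q by e, so only finitely many e are degenerate;
   the compensating shift of b1 preserves the trace condition. *)
Lemma even_family_square : trace_condition m a1 a2 b3 c b1 b2 ->
  A *m A = (a1 + a2) *: A - (a1 * a2)%:M.
Proof.
move=> tr.
(* The entry [b2] occurs m - 1 times on the diagonal. *)
pose n : F := (m - 1)%:R.
pose Ae e := Bmx m a1 a2 (b1 - n * e) (b2 + e) b3 c + Cmx m a1 a2 (b2 + e) b3 c.
(* A shift by [e] makes some q vanish only if [e] is the opposite of an unshifted q. *)
pose bad := [seq - qq a1 a2 b2 b3 c t s | t <- iota 0 m.+1, s <- iota 0 (2 * m)].
have sq e : e \notin bad -> Ae e *m Ae e = (a1 + a2) *: Ae e - (a1 * a2)%:M.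
  move=> ebad; apply: even_family_square_generic => //.
    by rewrite /trace_condition tr /n; ring.
  move=> t s ht hs; apply: contraNneq ebad => q0.
  apply/allpairsP; exists (t, s); rewrite !mem_iota /=.
  split; [lia | lia | rewrite -[LHS]subr0 -q0 /qq; ring].
have -> : A = Ae 0 by rewrite /Ae mulr0 subr0 addr0.
apply/matrixP => i j; apply/eqP; rewrite -subr_eq0; apply/eqP.
(* The defect in one entry is polynomial in [e] and zero off [bad], hence also at [e = 0]. *)
pose f e := (Ae e *m Ae e) i j - ((a1 + a2) *: Ae e - (a1 * a2)%:M) i j.
apply: (@polyfun_eq0 _ f bad) => [|e ebad]; last by rewrite /f sq ?subrr.
have [p pE] : polyfun (fun e => \sum_k Ae e i k * Ae e k j
    - ((a1 + a2) * Ae e i j - (a1 * a2) *+ (i == j))).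
  apply: polyfunD.
    by apply: polyfun_sum => k; apply: polyfunM; exact: polyfun_entry.
  apply: polyfunN; apply: polyfunD; last exact: polyfun_cst.
  by apply: polyfunM; [exact: polyfun_cst | exact: polyfun_entry].
exists p => e; rewrite /f -pE [(_ *m _) i j]mxE; congr (_ - _).
by rewrite [LHS]mxE [in LHS]mxE [(- _%:M) i j]mxE [(_%:M) i j]mxE.
Qed.

Lemma even_family_trace : \tr A =
  b1 + (m - 1)%:R * b2 + m%:R * b3 + \sum_(1 <= i < (2 * m).+1) c i.
Proof.
have m_gt0 : (0 < m)%N by lia.
transitivity (\sum_(1 <= k < (2 * m).+1) Arev m a1 a2 b1 b2 b3 c k k).
  rewrite /mxtrace big_nat_rev /= big_add1 /= big_mkord.
  apply: eq_bigr => i _; rewrite !mxE /Arev; have := ltn_ord i => hi.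
  by rewrite (_ : 2 * m + 1 - _ = i.+1)%N //; lia.
rewrite !big_nat_recr /=; [|lia|lia].
rewrite !(@big_cat_nat _ _ _ m.+1 1 (2 * m)) /=; [|lia|lia|lia|lia].
have -> : \sum_(1 <= k < m.+1) Arev m a1 a2 b1 b2 b3 c k k =
    m%:R * b3 + \sum_(1 <= k < m.+1) c k.
  rewrite mulr_natl (_ : b3 *+ m = b3 *+ (m.+1 - 1)); last by rewrite subn1.
  rewrite -sumr_const_nat -big_split /=.
  by apply: eq_big_nat => k hk; rewrite Arev_TT ?eqxx //; lia.
have -> : \sum_(m.+1 <= k < 2 * m) Arev m a1 a2 b1 b2 b3 c k k =
    (m - 1)%:R * b2 + \sum_(m.+1 <= k < 2 * m) c k.
  rewrite mulr_natl (_ : m - 1 = 2 * m - m.+1)%N; last by lia.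
  rewrite -sumr_const_nat -big_split /=.
  by apply: eq_big_nat => k hk; rewrite Arev_SS ?eqxx //; lia.
by rewrite Arev_oo //; ring.
Qed.

End Perturbation.

(** * Diagonalizability and multiplicities for the even family *)

Local Open Scope complex_scope.

Theorem theorem2p9 (R : realType) (m : nat) (a1 a2 b1 b2 b3 : R[i])
    (c : nat -> R[i]) :
  (2 <= m)%N ->
  a1 != a2 ->
  b1 != b2 -> b1 != b3 -> b2 != b3 ->
  (forall i j : nat, (1 <= i <= 2 * m)%N -> (1 <= j <= 2 * m)%N ->
     i != j -> c i != c j) ->
  m%:R * a1 + m%:R * a2
    = b1 + (m - 1)%:R * b2 + m%:R * b3 + \sum_(1 <= i < (2 * m).+1) c i ->
  let A := Bmx m a1 a2 b1 b2 b3 c + Cmx m a1 a2 b2 b3 c in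
  diagonalizable A /\
  char_poly A = ('X - a1%:P) ^+ m * ('X - a2%:P) ^+ m.
Proof.
move=> m_ge2 a12 _ _ _ c_inj tr A.
have Asq := even_family_square m_ge2 c_inj tr.
split; first exact: quadratic_diagonalizable Asq a12.
apply: (quadratic_char_poly Asq) => //.
by rewrite even_family_trace.
Qed.
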